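(* Let $k$ be a difference ring, and let $A$ be a $k$-algebra. The following statements are equivalent: (1) $A$ is finitely $\boldsymbol{\sigma}$-presented; (2) $A$ fits into a coequaliser diagram $P_{m,k}\rightrightarrows P_{n,k}\to A$ of some difference polynomial rings in finitely many variables over $k$; (3) $A$ fits into a coequaliser diagram $\lceil A_0|^k\rightrightarrows\lceil C_0|^k\to A$, where $A_0$ and $C_0$ are finitely presented $\lfloor k\rfloor$-algebras; (4) there exists a cocorrespondence $(A_0\to C_0\leftarrow A_0)$ of finitely presented $\lfloor k\rfloor$-algebras so that $A\simeq\lceil A_0;C_0|^k$.
   Context: A difference ring is a commutative unital ring with an endomorphism $\sigma$; $\lfloor R\rfloor$ is the underlying ring. For a difference ring $k$, $k\text{-}\mathbf{Alg}$ is the category of difference rings $A$ with a difference ring morphism $k\to A$, with morphisms of difference rings over $k$; coequalisers are taken in $k\text{-}\mathbf{Alg}$. The difference polynomial ring in $n$ variables is $P_{n,k}=k\{x_1,\dots,x_n\}=\lfloor k\rfloor[\sigma^i(x_j):i\ge0,1\le j\le n]$, with $\sigma$ extending $\sigma_k$ by $\sigma^i(x_j)\mapsto\sigma^{i+1}(x_j)$. A difference ideal of a difference ring $R$ is an ideal $I$ with $\sigma_R(I)\subseteq I$; it is finitely $\boldsymbol{\sigma}$-generated if there is a finite $B\subseteq I$ such that $I$ is generated as an ideal by $B,\sigma_R(B),\sigma_R^2(B),\dots$. A $k$-algebra is finitely $\boldsymbol{\sigma}$-presented if it is a quotient of some $P_{n,k}$ ($n$ finite) by a finitely $\boldsymbol{\sigma}$-generated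 difference ideal. $\lceil\,\cdot\,|^k:\lfloor k\rfloor\text{-}\mathbf{Alg}\to k\text{-}\mathbf{Alg}$ is the left adjoint of the forgetful functor. A cocorrespondence $A_0\xrightarrow{p}C_0\xleftarrow{s}A_0$ of $\lfloor k\rfloor$-algebras consists of a $\lfloor k\rfloor$-algebra homomorphism $p$ and a ring homomorphism $s$ with $s(\lambda a)=\sigma_k(\lambda)s(a)$ for $\lambda\in k$. A morphism of cocorrespondences $(A_0\to C_0\leftarrow A_0)\to(A_0'\to C_0'\leftarrow A_0')$ is a pair of $\lfloor k\rfloor$-algebra homomorphisms $A_0\to A_0'$, $C_0\to C_0'$ commuting with the structure maps. $\lceil A_0;C_0|^k$ is the value at the given cocorrespondence of the left adjoint to the functor sending a $k$-algebra $B$ to the cocorrespondence $B\xrightarrow{\mathrm{id}}B\xleftarrow{\sigma_B}B$; equivalently it represents $B\mapsto\{c\in\lfloor k\rfloor\text{-}\mathbf{Alg}(C_0,\lfloor B\rfloor):\sigma_B\circ c\circ p=c\circ s\}$. *)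

(* Defs.v *)
From HB Require Import structures.
From mathcomp Require Import all_boot all_order all_algebra.
From mathcomp Require Import finmap monalg.

Set Implicit Arguments.
Unset Strict Implicit.
Unset Printing Implicit Defensive.

Import GRing.Theory.
Local Open Scope ring_scope.

(* Throughout, rings are [comPzRingType]s: the zero ring is a difference ring,
   and it occurs as a quotient, so [comNzRingType] would be too restrictive.
   The library rings {mpoly R[n]} and {malg R[K]} and the structure [comAlgType]
   exclude the zero ring; hence polynomial rings are rebuilt below on the
   additive group {malg R[{cmonom I}]}, and an algebra is a ring with a
   structure morphism. *)

Definition cpoly (R : comPzRingType) (I : choiceType) : Type :=
  {malg R[{cmonom I}]}.

Section LinearExtension.
Variables (K : choiceType) (G V : zmodType).

Lemma zmod_morphism0 (U : zmodType) (f : U -> V) : zmod_morphism f -> f 0 = 0.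
Proof. by move=> fB; rewrite -[X in f X](subrr 0) fB subrr. Qed.

Lemma zmod_morphismD (U : zmodType) (f : U -> V) : zmod_morphism f ->
  {morph f : x y / x + y}.
Proof.
by move=> fB x y; apply/eqP; rewrite -subr_eq -fB addrK.
Qed.

Lemma malg_additive_ext (f g : {malg G[K]} -> V) :
  zmod_morphism f -> zmod_morphism g ->
  (forall c m, f << c *g m >> = g << c *g m >>) -> f =1 g.
Proof.
move=> fB gB fg x; rewrite [x]monalgE.
elim/big_rec: _ => [|m y _ IHy]; first by rewrite !zmod_morphism0.
by rewrite !zmod_morphismD // fg IHy.
Qed.

(* The additive map sending << c *g m >> to F m c, for F m additive. *)
Definition malg_lift (F : K -> G -> V) (g : {malg G[K]}) : V :=
  \sum_(m <- msupp g) F m g@_m.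

Variable F : K -> G -> V.
Hypothesis F_additive : forall m, zmod_morphism (F m).

Lemma malg_liftEw (d : {fset K}) g :
  (msupp g `<=` d)%fset -> malg_lift F g = \sum_(m <- d) F m g@_m.
Proof.
move=> le; rewrite /malg_lift (big_fset_incl _ le) //= => m _ /mcoeff_outdom ->.
exact: zmod_morphism0.
Qed.

Lemma malg_liftU c m : malg_lift F << c *g m >> = F m c.
Proof. by rewrite (malg_liftEw msuppU_le) big_seq_fset1 mcoeffUU. Qed.

Lemma malg_liftB : zmod_morphism (malg_lift F).
Proof.
move=> g1 g2; rewrite (malg_liftEw (msuppB_le g1 g2)).
rewrite [malg_lift F g2](malg_liftEw (fsubsetUr (msupp g1) _)).
rewrite (malg_liftEw (fsubsetUl _ (msupp g2))) -sumrB.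
by apply: eq_bigr => m _; rewrite mcoeffB F_additive.
Qed.

End LinearExtension.

HB.instance Definition _ (R : comPzRingType) (I : choiceType) :=
  GRing.Zmodule.copy (cpoly R I) {malg R[{cmonom I}]}.

(* Locked, like cpoly_mul and cpoly_eval: comparing supports by conversion
   does not terminate in practice. *)
HB.lock Definition cpolyM (R : comPzRingType) (I : choiceType)
  (m : {cmonom I}) (c : R) : cpoly R I := << c *g m >>.

HB.lock Definition cpoly_mul (R : comPzRingType) (I : choiceType)
    (p q : cpoly R I) : cpoly R I :=
  \sum_(m1 <- msupp p) \sum_(m2 <- msupp q)
    cpolyM (mmul m1 m2) (p@_m1 * q@_m2).

Section PolynomialRing.
Variables (R : comPzRingType) (I : choiceType).

Implicit Types p q r : cpoly R I.
Local Notation cpolyM := (@cpolyM R I).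
Local Notation cpoly_mul := (@cpoly_mul R I).

Definition cpolyC (c : R) : cpoly R I := cpolyM mone c.
Definition cpolyX (i : I) : cpoly R I := cpolyM (ucm i) 1.

Definition cpoly_one : cpoly R I := cpolyC 1.

Lemma cpolyME (m : {cmonom I}) (c : R) : cpolyM m c = << c *g m >>.
Proof. by rewrite unlock. Qed.

Lemma cpolyMB m : zmod_morphism (cpolyM m).
Proof. by rewrite unlock => a b; exact: monalgUB. Qed.

Lemma cpoly_ext (V : zmodType) (f g : cpoly R I -> V) :
  zmod_morphism f -> zmod_morphism g ->
  (forall c m, f (cpolyM m c) = g (cpolyM m c)) -> f =1 g.
Proof. by rewrite unlock; apply: malg_additive_ext. Qed.

Let mulM (m1 : {cmonom I}) (c1 : R) (m2 : {cmonom I}) (c2 : R) : cpoly R I :=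
  cpolyM (mmul m1 m2) (c1 * c2).
Let mulMB m1 c1 m2 : zmod_morphism (mulM m1 c1 m2).
Proof. by move=> a b; rewrite /mulM mulrBr cpolyMB. Qed.

Let mulML q (m1 : {cmonom I}) (c1 : R) : cpoly R I := malg_lift (mulM m1 c1) q.
Let mulMLB q m1 : zmod_morphism (mulML q m1).
Proof.
move=> a b; rewrite /mulML /malg_lift -sumrB; apply: eq_bigr => m2 _.
by rewrite /mulM mulrBl cpolyMB.
Qed.

Let cpoly_mulE p q : cpoly_mul p q = malg_lift (mulML q) p.
Proof. by rewrite cpoly_mul.unlock. Qed.

Lemma cpoly_mulM (c1 c2 : R) (m1 m2 : {cmonom I}) :
  cpoly_mul (cpolyM m1 c1) (cpolyM m2 c2) = cpolyM (mmul m1 m2) (c1 * c2).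
Proof.
rewrite cpoly_mulE [cpolyM m1 c1]cpolyME malg_liftU //.
by rewrite /mulML [cpolyM m2 c2]cpolyME malg_liftU.
Qed.

Lemma cpoly_mulBl q : zmod_morphism (cpoly_mul^~ q).
Proof. by move=> p1 p2; rewrite !cpoly_mulE (malg_liftB (mulMLB q)). Qed.

Lemma cpoly_mulBr p : zmod_morphism (cpoly_mul p).
Proof.
move=> q1 q2; rewrite !cpoly_mulE /malg_lift -sumrB; apply: eq_bigr => m1 _.
exact: (malg_liftB (mulMB m1 p@_m1)).
Qed.

Lemma cpoly_mulC : commutative cpoly_mul.
Proof.
move=> p q; move: p; apply: cpoly_ext (cpoly_mulBl q) (cpoly_mulBr q) _ => c m.
move: q; apply: cpoly_ext (cpoly_mulBr _) (cpoly_mulBl _) _ => d l.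
by rewrite 2!cpoly_mulM [c * d]mulrC [mmul m l]mulmC.
Qed.

Lemma cpoly_mulA : associative cpoly_mul.
Proof.
move=> p q r; move: p; apply: cpoly_ext => [x y|x y|c m].
- exact: cpoly_mulBl.
- by rewrite !cpoly_mulBl.
move: q; apply: cpoly_ext => [x y|x y|d l].
- by rewrite cpoly_mulBl cpoly_mulBr.
- by rewrite cpoly_mulBr cpoly_mulBl.
move: r; apply: cpoly_ext => [x y|x y|e n].
- by rewrite !cpoly_mulBr.
- exact: cpoly_mulBr.
by rewrite 4!cpoly_mulM mulrA mulmA.
Qed.

Lemma cpoly_mul1 : left_id cpoly_one cpoly_mul.
Proof.
apply: cpoly_ext => [||c m]; [exact: cpoly_mulBr | by [] |].
by rewrite cpoly_mulM mul1r mul1m.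
Qed.

Lemma cpoly_mulDl : left_distributive cpoly_mul +%R.
Proof. by move=> p q r; exact: (zmod_morphismD (cpoly_mulBl r)). Qed.

HB.instance Definition _ := GRing.Zmodule_isComPzRing.Build (cpoly R I)
  cpoly_mulA cpoly_mulC cpoly_mul1 cpoly_mulDl.

Lemma cpolyC_zmod_morphism : zmod_morphism cpolyC.
Proof. exact: cpolyMB. Qed.
Lemma cpolyC_monoid_morphism : monoid_morphism cpolyC.
Proof. by split=> // a b; rewrite /GRing.mul /= cpoly_mulM mul1m. Qed.
HB.instance Definition _ :=
  GRing.isZmodMorphism.Build R (cpoly R I) cpolyC cpolyC_zmod_morphism.
HB.instance Definition _ :=
  GRing.isMonoidMorphism.Build R (cpoly R I) cpolyC cpolyC_monoid_morphism.

End PolynomialRing.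

Definition cmonom_eval (S : comPzRingType) (I : choiceType) (h : I -> S)
    (m : {cmonom I}) : S :=
  \prod_(i <- finsupp m) h i ^+ m i.

(* The ring morphism extending f and sending x_i to h i. *)
HB.lock Definition cpoly_eval (R S : comPzRingType) (I : choiceType)
    (f : {rmorphism R -> S}) (h : I -> S) (p : cpoly R I) : S :=
  \sum_(m <- msupp p) f p@_m * cmonom_eval h m.

Section Evaluation.
Variables (R S : comPzRingType) (I : choiceType).
Variables (f : {rmorphism R -> S}) (h : I -> S).
Local Notation cmonom_eval := (cmonom_eval h).
Local Notation cpoly_eval := (@cpoly_eval R S I f h).

Lemma cmonom_evalEw (d : {fset I}) (m : {cmonom I}) :
  (finsupp m `<=` d)%fset -> cmonom_eval m = \prod_(i <- d) h i ^+ m i.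
Proof.
move=> le; rewrite /Defs.cmonom_eval (big_fset_incl _ le) //= => i _.
by rewrite -cmE_eq0 => /eqP ->; rewrite expr0.
Qed.

Lemma cmonom_evalM m1 m2 :
  cmonom_eval (mmul m1 m2) = cmonom_eval m1 * cmonom_eval m2.
Proof.
rewrite /Defs.cmonom_eval mdomD -/(cmonom_eval m1) -/(cmonom_eval m2).
rewrite (cmonom_evalEw (fsubsetUl _ (finsupp m2))).
rewrite (cmonom_evalEw (fsubsetUr (finsupp m1) _)) -big_split.
by apply: eq_bigr => i _; rewrite cmM exprD.
Qed.

Lemma cmonom_eval1 : cmonom_eval mone = 1.
Proof. by rewrite /Defs.cmonom_eval mdom1 big_seq_fset0. Qed.

Lemma cmonom_evalU i : cmonom_eval (ucm i) = h i.
Proof. by rewrite /Defs.cmonom_eval mdomU big_seq_fset1 cmUU expr1. Qed.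

Let evalM (m : {cmonom I}) (c : R) : S := f c * cmonom_eval m.
Let evalMB m : zmod_morphism (evalM m).
Proof. by move=> a b; rewrite /evalM raddfB mulrBl. Qed.

Let cpoly_evalE p : cpoly_eval p = malg_lift evalM p.
Proof. by rewrite cpoly_eval.unlock. Qed.

Lemma cpoly_evalM c m : cpoly_eval (cpolyM m c) = f c * cmonom_eval m.
Proof. by rewrite cpoly_evalE cpolyME (malg_liftU evalMB). Qed.

Lemma cpoly_eval_zmod_morphism : zmod_morphism cpoly_eval.
Proof. by move=> p q; rewrite !cpoly_evalE (malg_liftB evalMB). Qed.
HB.instance Definition _ := GRing.isZmodMorphism.Build (cpoly R I) S cpoly_eval
  cpoly_eval_zmod_morphism.

Lemma cpoly_evalC c : cpoly_eval (cpolyC I c) = f c.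
Proof. by rewrite cpoly_evalM cmonom_eval1 mulr1. Qed.

Lemma cpoly_evalX i : cpoly_eval (cpolyX R i) = h i.
Proof. by rewrite cpoly_evalM rmorph1 mul1r cmonom_evalU. Qed.

Lemma cpoly_eval_monoid_morphism : monoid_morphism cpoly_eval.
Proof.
split=> [|p q]; first by rewrite cpoly_evalC rmorph1.
move: p; apply: cpoly_ext => [x y|x y|c m].
- by rewrite mulrBl raddfB.
- by rewrite raddfB mulrBl.
move: q; apply: cpoly_ext => [x y|x y|d l].
- by rewrite mulrBr raddfB.
- by rewrite raddfB mulrBr.
by rewrite [_ * _]cpoly_mulM !cpoly_evalM rmorphM cmonom_evalM mulrACA.
Qed.
HB.instance Definition _ := GRing.isMonoidMorphism.Build (cpoly R I) S cpoly_eval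
  cpoly_eval_monoid_morphism.

End Evaluation.

Record alg (R : comPzRingType) := Alg {
  alg_ring :> comPzRingType;
  alg_map : {rmorphism R -> alg_ring}
}.

Record algHom (R : comPzRingType) (A B : alg R) := AlgHom {
  algHom_fun :> {rmorphism A -> B};
  algHom_map : forall c : R, algHom_fun (alg_map A c) = alg_map B c
}.

Definition algHom_id (R : comPzRingType) (A : alg R) : algHom A A :=
  @AlgHom R A A idfun (fun c => erefl).

Record diffRing := DiffRing {
  diffRing_ring :> comPzRingType;
  sigma : {rmorphism diffRing_ring -> diffRing_ring}
}.
Arguments sigma {_}.

Record diffHom (R S : diffRing) := DiffHom {
  diffHom_fun :> {rmorphism R -> S};
  diffHom_sigma : forall x : R, diffHom_fun (sigma x) = sigma (diffHom_fun x)
}.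

Record diffAlg (k : diffRing) := DiffAlg {
  diffAlg_ring :> diffRing;
  diffAlg_map : diffHom k diffAlg_ring
}.

Record diffAlgHom (k : diffRing) (A B : diffAlg k) := DiffAlgHom {
  diffAlgHom_fun :> diffHom A B;
  diffAlgHom_map : forall c : k, diffAlgHom_fun (diffAlg_map A c) = diffAlg_map B c
}.

Definition diffAlg_iso (k : diffRing) (A B : diffAlg k) : Prop :=
  exists (u : diffAlgHom A B) (v : diffAlgHom B A), cancel u v /\ cancel v u.

Definition floor_alg (k : diffRing) (A : diffAlg k) : alg k :=
  Alg (diffAlg_map A).

Definition floor_algHom (k : diffRing) (A B : diffAlg k) (u : diffAlgHom A B) :
    algHom (floor_alg A) (floor_alg B) :=
  @AlgHom k (floor_alg A) (floor_alg B) u (diffAlgHom_map u).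

(* The variable indexed by (i, j) is sigma^i(x_j). *)
Definition diffPoly_sigma (n : nat) (k : diffRing) :
    {rmorphism cpoly k (nat * 'I_n)%type -> cpoly k (nat * 'I_n)%type} :=
  cpoly_eval (cpolyC (nat * 'I_n)%type \o @sigma k)
             (fun v : nat * 'I_n => cpolyX k (v.1.+1, v.2)).

Lemma diffPoly_sigmaC (n : nat) (k : diffRing) (c : k) :
  diffPoly_sigma n k (cpolyC (nat * 'I_n)%type c) =
  cpolyC (nat * 'I_n)%type (sigma c).
Proof. by rewrite /diffPoly_sigma /= cpoly_evalC. Qed.

Lemma diffPoly_sigmaX (n : nat) (k : diffRing) (i : nat) (j : 'I_n) :
  diffPoly_sigma n k (cpolyX k (i, j)) = cpolyX k (i.+1, j).
Proof. by rewrite /diffPoly_sigma /= cpoly_evalX. Qed.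

Definition diffPoly_ring (n : nat) (k : diffRing) : diffRing :=
  DiffRing (diffPoly_sigma n k).

Definition diffPoly (n : nat) (k : diffRing) : diffAlg k :=
  @DiffAlg k (diffPoly_ring n k)
    (@DiffHom k (diffPoly_ring n k) (@cpolyC k (nat * 'I_n)%type)
       (fun c => esym (diffPoly_sigmaC n c))).

Definition is_ideal (R : comPzRingType) (J : R -> Prop) : Prop :=
  [/\ J 0, forall x y, J x -> J y -> J (x + y) & forall a x, J x -> J (a * x)].

Definition ideal_gen (R : comPzRingType) (B : R -> Prop) (x : R) : Prop :=
  forall J, is_ideal J -> (forall y, B y -> J y) -> J x.

Definition is_diff_ideal (R : diffRing) (J : R -> Prop) : Prop :=
  is_ideal J /\ forall x, J x -> J (sigma x).

Definition fin_gen (R : comPzRingType) (J : R -> Prop) : Prop :=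
  exists B : seq R, forall x, J x <-> ideal_gen (fun y => y \in B) x.

Definition fin_sigma_gen (R : diffRing) (J : R -> Prop) : Prop :=
  exists2 B : seq R, forall b, b \in B -> J b &
    forall x, J x <->
      ideal_gen (fun y => exists (i : nat) (b : R),
                   b \in B /\ y = iter i (@sigma R) b) x.

(* A is isomorphic to P / J over R, via the isomorphism theorem: there is a
   surjective morphism P -> A with kernel J. *)
Definition is_quotient (R : comPzRingType) (P A : alg R) (J : P -> Prop) : Prop :=
  exists pi : algHom P A,
    (forall a, exists p, pi p = a) /\ (forall p, pi p = 0 <-> J p).

Definition is_diff_quotient (k : diffRing) (P A : diffAlg k) (J : P -> Prop) :
    Prop :=
  exists pi : diffAlgHom P A,
    (forall a, exists p, pi p = a) /\ (forall p, pi p = 0 <-> J p).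

Definition fin_presented (R : comPzRingType) (A : alg R) : Prop :=
  exists (n : nat) (J : cpoly R 'I_n -> Prop),
    [/\ is_ideal J, fin_gen J
      & @is_quotient R (Alg (@cpolyC R 'I_n)) A J].

Definition fin_sigma_presented (k : diffRing) (A : diffAlg k) : Prop :=
  exists (n : nat) (J : diffPoly n k -> Prop),
    [/\ is_diff_ideal J, fin_sigma_gen J & is_diff_quotient A J].

Definition is_coequaliser (k : diffRing) (X Y A : diffAlg k)
    (f g : diffAlgHom X Y) (q : diffAlgHom Y A) : Prop :=
  (forall x, q (f x) = q (g x)) /\
  forall (B : diffAlg k) (h : diffAlgHom Y B),
    (forall x, h (f x) = h (g x)) ->
    exists2 u : diffAlgHom A B, (forall y, u (q y) = h y) &
      forall u' : diffAlgHom A B, (forall y, u' (q y) = h y) -> u' =1 u.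

(* L is the value at A0 of the left adjoint of floor_alg, with unit eta. *)
Definition is_free_diffAlg (k : diffRing) (A0 : alg k) (L : diffAlg k)
    (eta : algHom A0 (floor_alg L)) : Prop :=
  forall (B : diffAlg k) (f : algHom A0 (floor_alg B)),
    exists2 h : diffAlgHom L B, (forall a, floor_algHom h (eta a) = f a) &
      forall h' : diffAlgHom L B,
        (forall a, floor_algHom h' (eta a) = f a) -> h' =1 h.

Record cocorr (k : diffRing) := Cocorr {
  cocorr_src : alg k;
  cocorr_tgt : alg k;
  cocorr_p : algHom cocorr_src cocorr_tgt;
  cocorr_s : {rmorphism cocorr_src -> cocorr_tgt};
  cocorr_sE : forall (c : k) (a : cocorr_src),
    cocorr_s (alg_map cocorr_src c * a) =
    alg_map cocorr_tgt (sigma c) * cocorr_s a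
}.

Record cocorrHom (k : diffRing) (X Y : cocorr k) := CocorrHom {
  cocorrHom_src : algHom (cocorr_src X) (cocorr_src Y);
  cocorrHom_tgt : algHom (cocorr_tgt X) (cocorr_tgt Y);
  cocorrHom_p : forall a,
    cocorrHom_tgt (cocorr_p X a) = cocorr_p Y (cocorrHom_src a);
  cocorrHom_s : forall a,
    cocorrHom_tgt (cocorr_s X a) = cocorr_s Y (cocorrHom_src a)
}.

Lemma diffAlg_sigma_semilinear (k : diffRing) (B : diffAlg k) (c : k) (b : B) :
  sigma (diffAlg_map B c * b) = diffAlg_map B (sigma c) * sigma b.
Proof. by rewrite rmorphM diffHom_sigma. Qed.

(* The functor B |-> (B -id-> B <-sigma- B). *)
Definition diffAlg_cocorr (k : diffRing) (B : diffAlg k) : cocorr k :=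
  @Cocorr k (floor_alg B) (floor_alg B) (algHom_id (floor_alg B)) (@sigma B)
    (@diffAlg_sigma_semilinear k B).

Definition diffAlg_cocorrHom (k : diffRing) (A B : diffAlg k)
    (u : diffAlgHom A B) : cocorrHom (diffAlg_cocorr A) (diffAlg_cocorr B) :=
  @CocorrHom k (diffAlg_cocorr A) (diffAlg_cocorr B)
    (floor_algHom u) (floor_algHom u) (fun=> erefl) (diffHom_sigma u).

(* L is the value at X of the left adjoint of diffAlg_cocorr, with unit eta. *)
Definition is_free_cocorr (k : diffRing) (X : cocorr k) (L : diffAlg k)
    (eta : cocorrHom X (diffAlg_cocorr L)) : Prop :=
  let extends (B : diffAlg k) (h : diffAlgHom L B)
      (f : cocorrHom X (diffAlg_cocorr B)) :=
    (forall a, cocorrHom_src (diffAlg_cocorrHom h) (cocorrHom_src eta a)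
               = cocorrHom_src f a) /\
    (forall c, cocorrHom_tgt (diffAlg_cocorrHom h) (cocorrHom_tgt eta c)
               = cocorrHom_tgt f c) in
  forall (B : diffAlg k) (f : cocorrHom X (diffAlg_cocorr B)),
    exists2 h : diffAlgHom L B, extends B h f &
      forall h' : diffAlgHom L B, extends B h' f -> h' =1 h.

(* Main.v *)
Require Import Defs.
From HB Require Import structures.
From mathcomp Require Import all_boot all_order all_algebra.
From mathcomp Require Import finmap monalg boolp.

(** Everything reduces to presentations: an algebra is recovered, up to
isomorphism, from the functor it represents, and each of the four conditions
describes that functor by finitely many difference equations in finitely many
unknowns.

The transfer principle is [diff_quotient_of_universal]: a morphism from a
difference algebra P to A which kills a difference ideal J, through which every
morphism killing J factors, and such that only the identity endomorphism of A
fixes its image, is surjective with kernel J. It is proved by comparing A with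
the quotient of P by J. It turns coequalisers and free algebras into
presentations, without an explicit construction of either.

A finitely sigma-presented A, with relations b_1, ..., b_m, is the coequaliser
of x_j |-> b_j and x_j |-> 0 ([fin_sigma_presented_coeq]). Since P_n is free on
the polynomial ring in n variables ([diffPoly_free]), this is also a
coequaliser of free algebras on finitely presented ones.

Conversely, such a coequaliser is finitely sigma-presented: the free algebra on
a finitely presented C_0 has the presentation of C_0, read in order 0
([free_fin_sigma_presented]), and a coequaliser of two morphisms between
finitely sigma-presented algebras is obtained by imposing the finitely many
equations f(x_j) = g(x_j), for x_j generating the source
([coeq_fin_sigma_presented]).

A presentation yields a cocorrespondence by bounding the order: the finitely
many relations involve only variables sigma^i(x_j) with i <= N. Truncation at
order N turns the difference equations into algebraic equations in the
variables x_(i,j), i <= N, which define C_0, together with the conditions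
x_(i+1,j) = sigma(x_(i,j)), i < N, which are expressed by a cocorrespondence
from the polynomial ring A_0 in the variables x_(i,j), i < N
([fin_sigma_presented_cocorr]).

In the other direction, a morphism out of the free algebra on a
cocorrespondence is a point c of C_0 with c s = sigma c p, and because both
sides are semilinear ring morphisms on A_0, this condition need only be imposed
on the finitely many generators of A_0 ([cocorr_fin_sigma_presented]). *)

Set Implicit Arguments.
Unset Strict Implicit.
Unset Printing Implicit Defensive.

Import GRing.Theory.
Local Open Scope ring_scope.

(** * Polynomial rings *)

Section PolyInduction.
Variables (R : comPzRingType) (I : choiceType).

Lemma cpolyM_prod (m : {cmonom I}) (c : R) :
  cpolyM m c = cpolyC I c * \prod_(i <- finsupp m) cpolyX R i ^+ m i.
Proof.
have expE i e : cpolyX R i ^+ e = cpolyM (iterop e mmul (ucm i) mone) 1.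
  elim: e => [|e IHe]; first by rewrite expr0.
  rewrite exprS IHe [LHS]cpoly_mulM mulr1; congr cpolyM.
  by case: e {IHe} => [|e] /=; rewrite ?mulm1.
have iterE (i j : I) e : (iterop e mmul (ucm i) mone : {cmonom I}) j
                          = ((i == j) * e)%N.
  elim: e => [|e IHe]; first by rewrite cm1 muln0.
  have -> : iterop e.+1 mmul (ucm i) mone =
            mmul (ucm i) (iterop e mmul (ucm i) mone).
    by case: e {IHe} => [|e] /=; rewrite ?mulm1.
  by rewrite cmM IHe cmU mulnS.
have prodE (r : seq I) : \prod_(i <- r) cpolyX R i ^+ m i =
    cpolyM (\big[mmul/mone]_(i <- r) iterop (m i) mmul (ucm i) mone) 1.
  elim: r => [|i r IHr]; first by rewrite !big_nil.
  by rewrite !big_cons IHr expE [LHS]cpoly_mulM mulr1.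
rewrite prodE [RHS]cpoly_mulM mulr1 mul1m; congr cpolyM.
apply/eqP/cmP => j.
have bigE (r : seq I) : uniq r ->
    (\big[mmul/mone]_(i <- r) iterop (m i) mmul (ucm i) mone : {cmonom I}) j
    = ((j \in r) * m j)%N.
  elim: r => [|i r IHr] /=; first by rewrite big_nil cm1.
  case/andP=> ir ur; rewrite big_cons cmM IHr // iterE inE eq_sym.
  by case: eqVneq => [->|//]; rewrite (negbTE ir) addn0.
rewrite bigE ?fset_uniq //; case: finsuppP => [|_]; last by rewrite mul1n.
by rewrite muln0.
Qed.

(** Polynomials are generated by constants and variables; every later
statement that a property or a morphism is determined on variables rests on
this principle. *)
Lemma cpoly_ind (P : cpoly R I -> Prop) :
  (forall c, P (cpolyC I c)) -> (forall i, P (cpolyX R i)) ->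
  (forall p q, P p -> P q -> P (p + q)) ->
  (forall p q, P p -> P q -> P (p * q)) -> forall p, P p.
Proof.
move=> PC PX PD PM p.
have P1 : P 1 by exact: PC.
have P0 : P 0 by have := PC 0; rewrite raddf0.
have PX' e i : P (cpolyX R i ^+ e).
  by elim: e => [|e IHe]; [rewrite expr0 | rewrite exprS; apply: PM].
rewrite [p]monalgE; elim/big_rec: _ => [|m q _ Pq]; first exact: P0.
apply: (PD) (Pq); rewrite -cpolyME cpolyM_prod; apply: (PM); first exact: PC.
by elim/big_rec: _ => // i q' _; apply: PM.
Qed.

Lemma cpoly_rmorph_ext (S : comPzRingType) (f g : {rmorphism cpoly R I -> S}) :
  (forall c, f (cpolyC I c) = g (cpolyC I c)) ->
  (forall i, f (cpolyX R i) = g (cpolyX R i)) -> f =1 g.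
Proof.
move=> fgC fgX; apply: cpoly_ind => // p q fgp fgq.
  by rewrite !rmorphD fgp fgq.
by rewrite !rmorphM fgp fgq.
Qed.

End PolyInduction.

(** * Quotients *)

Section Ideals.
Variables (R S : comPzRingType).

Lemma idealB (J : R -> Prop) x y : is_ideal J -> J x -> J y -> J (x - y).
Proof. by case=> _ JD JM Jx Jy; apply: JD; rewrite // -mulN1r; apply: JM. Qed.

Lemma ideal_gen_ideal (B : R -> Prop) : is_ideal (ideal_gen B).
Proof.
split=> [J [] //|x y Bx By J idJ BJ|a x Bx J idJ BJ].
  by case: (idJ) => _ JD _; apply: JD; [apply: Bx|apply: By].
by case: (idJ) => _ _; apply; apply: Bx.
Qed.

Lemma ideal_gen_sub (B : R -> Prop) x : B x -> ideal_gen B x.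
Proof. by move=> Bx J _; apply. Qed.

Lemma rmorph_preim_ideal (f : {rmorphism R -> S}) (J : S -> Prop) :
  is_ideal J -> is_ideal (fun x => J (f x)).
Proof.
case=> J0 JD JM; split=> [|x y|a x]; first by rewrite rmorph0.
  by rewrite rmorphD; apply: JD.
by rewrite rmorphM; apply: JM.
Qed.

Lemma zero_ideal : is_ideal (fun x : R => x = 0).
Proof.
by split=> // [x y -> ->|a x ->]; rewrite ?addr0 ?mulr0.
Qed.

End Ideals.

Lemma ideal_gen_kernel (R S : comPzRingType) (f : {rmorphism R -> S})
    (B : R -> Prop) :
  (forall x, B x -> f x = 0) -> forall x, ideal_gen B x -> f x = 0.
Proof.
move=> fB x /(_ (fun y => f y = 0)); apply=> //.
exact: (rmorph_preim_ideal f (zero_ideal S)).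
Qed.

Section QuotientRing.
Variables (R : comPzRingType) (J : R -> Prop) (idJ : is_ideal J).

(** The additive quotient is taken by a boolean subgroup, so membership in a
propositional ideal is decided classically. *)
Definition ideal_pred of is_ideal J : R -> bool := fun x => `[< J x >].

Lemma ideal_pred_closed : zmod_closed (ideal_pred idJ).
Proof.
split; first by apply/asboolP; case: idJ.
by move=> x y /asboolP Jx /asboolP Jy; apply/asboolP; apply: idealB.
Qed.
HB.instance Definition _ :=
  GRing.isZmodClosed.Build R (ideal_pred idJ) ideal_pred_closed.

(** The ideal need not be proper: inconsistent relations present the zero ring,
so the product is put by hand on the additive quotient. *)
Definition quot_ring :=
  Quotient.quot (GRing.ZmodClosed.clone R (ideal_pred idJ) _).
HB.instance Definition _ := GRing.Zmodule.on quot_ring.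

Definition quot_pi (x : R) : quot_ring :=
  (\pi_(Quotient.quot (GRing.ZmodClosed.clone R (ideal_pred idJ) _)) x)%qT.
Definition quot_repr (x : quot_ring) : R := generic_quotient.repr x.

Lemma quot_reprK : cancel quot_repr quot_pi.
Proof. exact: generic_quotient.reprK. Qed.

Lemma quot_piB : zmod_morphism quot_pi.
Proof. exact: pi_is_zmod_morphism. Qed.

Lemma quot_pi_eq x y : quot_pi x = quot_pi y <-> J (x - y).
Proof.
split=> [/eqP|Jxy]; last apply/eqP.
  by rewrite -Quotient.idealrBE => /asboolP.
by rewrite -Quotient.idealrBE; apply/asboolP.
Qed.

Definition quot_mul (x y : quot_ring) := quot_pi (quot_repr x * quot_repr y).

Lemma quot_piM x y : quot_mul (quot_pi x) (quot_pi y) = quot_pi (x * y).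
Proof.
apply/quot_pi_eq.
have Jr z : J (quot_repr (quot_pi z) - z).
  by apply/quot_pi_eq; rewrite quot_reprK.
case: idJ => _ JD JM.
set x' := quot_repr _; set y' := quot_repr _.
have -> : x' * y' - x * y = x' * (y' - y) + y * (x' - x).
  by rewrite !mulrBr addrA (mulrC y x') subrK (mulrC y).
by apply: JD; apply: JM; apply: Jr.
Qed.

Lemma quot_piW (P : quot_ring -> Prop) :
  (forall x, P (quot_pi x)) -> forall x, P x.
Proof. by move=> PP x; rewrite -[x]quot_reprK. Qed.

Lemma quot_mulA : associative quot_mul.
Proof.
elim/quot_piW=> x; elim/quot_piW=> y; elim/quot_piW=> z.
by rewrite !quot_piM mulrA.
Qed.
Lemma quot_mulC : commutative quot_mul.
Proof. by elim/quot_piW=> x; elim/quot_piW=> y; rewrite !quot_piM mulrC. Qed.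
Lemma quot_mul1 : left_id (quot_pi 1) quot_mul.
Proof. by elim/quot_piW=> x; rewrite quot_piM mul1r. Qed.
Lemma quot_mulDl : left_distributive quot_mul +%R.
Proof.
elim/quot_piW=> x; elim/quot_piW=> y; elim/quot_piW=> z.
rewrite -(zmod_morphismD quot_piB) !quot_piM mulrDl.
exact: (zmod_morphismD quot_piB).
Qed.
HB.instance Definition _ := GRing.Zmodule_isComPzRing.Build quot_ring
  quot_mulA quot_mulC quot_mul1 quot_mulDl.

HB.instance Definition _ :=
  GRing.isZmodMorphism.Build R quot_ring quot_pi quot_piB.
Lemma quot_pi_monoid_morphism : monoid_morphism quot_pi.
Proof. by split=> // x y; rewrite -quot_piM. Qed.
HB.instance Definition _ :=
  GRing.isMonoidMorphism.Build R quot_ring quot_pi quot_pi_monoid_morphism.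

Lemma quotient_ring_exists :
  exists (Q : comPzRingType) (pi : {rmorphism R -> Q}),
  (forall a, exists p, pi p = a) /\ (forall p, pi p = 0 <-> J p).
Proof.
exists quot_ring, quot_pi; split=> [a|p].
  by exists (quot_repr a); apply: quot_reprK.
by have := quot_pi_eq p 0; rewrite rmorph0 subr0.
Qed.

End QuotientRing.

Section Factorisation.
Variables (P A S : comPzRingType).
Variables (pi : {rmorphism P -> A}) (h : {rmorphism P -> S}).
Hypothesis pi_surj : forall a, exists p, pi p = a.
Hypothesis ker_le : forall p, pi p = 0 -> h p = 0.

(** The map is u(a) = h(r(a)) for any section r of [pi]: the kernel hypothesis
makes the choice of r irrelevant, hence u additive and multiplicative. *)
Lemma rmorph_factor : exists u : {rmorphism A -> S}, forall p, u (pi p) = h p.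
Proof.
have [r rK] := choice pi_surj.
have hE p q : pi p = pi q -> h p = h q.
  move=> epq; apply/eqP; rewrite -subr_eq0 -rmorphB; apply/eqP/ker_le.
  by rewrite rmorphB epq subrr.
pose u a := h (r a).
have uE p : u (pi p) = h p by apply: hE; rewrite rK.
have uB : zmod_morphism u.
  by move=> a b; rewrite -[a]rK -[b]rK -rmorphB !uE rmorphB.
have uM : monoid_morphism u.
  split; first by rewrite -(rmorph1 pi) uE rmorph1.
  by move=> a b; rewrite -[a]rK -[b]rK -rmorphM !uE rmorphM.
pose ua := GRing.isZmodMorphism.Build A S u uB.
pose um := GRing.isMonoidMorphism.Build A S u uM.
pose U : {rmorphism A -> S} := HB.pack u ua um.
by exists U.
Qed.

End Factorisation.

(** * Algebras over the base ring *)

Section Algebras.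
Variable R : comPzRingType.

Definition algHom_comp (A B C : alg R) (g : algHom B C) (f : algHom A B) :
    algHom A C.
Proof.
by exists (g \o f : {rmorphism A -> C}) => c; rewrite /= !algHom_map.
Defined.

Definition poly_alg (I : choiceType) : alg R := Alg (@cpolyC R I).

Definition poly_evalHom (I : choiceType) (A : alg R) (h : I -> A) :
    algHom (poly_alg I) A.
Proof.
exists (cpoly_eval (alg_map A) h : {rmorphism cpoly R I -> A}) => c.
exact: cpoly_evalC.
Defined.

Lemma poly_evalHomX (I : choiceType) (A : alg R) (h : I -> A) i :
  poly_evalHom h (cpolyX R i) = h i.
Proof. exact: cpoly_evalX. Qed.

Lemma poly_algHom_ext (I : choiceType) (A : alg R)
    (f g : algHom (poly_alg I) A) :
  (forall i, f (cpolyX R i) = g (cpolyX R i)) -> f =1 g.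
Proof.
apply: cpoly_rmorph_ext => c.
exact: etrans (algHom_map f c) (esym (algHom_map g c)).
Qed.

Lemma alg_quotient_exists (P : alg R) (J : P -> Prop) : is_ideal J ->
  exists Q : alg R, is_quotient Q J.
Proof.
move=> idJ; have [Q [pi piJ]] := quotient_ring_exists idJ.
pose Qa := Alg (pi \o alg_map P : {rmorphism R -> Q}).
by exists Qa; exists (@AlgHom R P Qa pi (fun=> erefl)).
Qed.

Lemma alg_factor (P A B : alg R) (pi : algHom P A) (h : algHom P B) :
  (forall a, exists p, pi p = a) -> (forall p, pi p = 0 -> h p = 0) ->
  exists u : algHom A B, forall p, u (pi p) = h p.
Proof.
move=> surj ker; have [u uE] := rmorph_factor surj ker.
have um c : u (alg_map A c) = alg_map B c.
  by rewrite -(algHom_map pi) uE algHom_map.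
by exists (AlgHom um).
Qed.

End Algebras.

(** * Difference ideals *)

Definition sigma_ideal (R : diffRing) (B : seq R) : R -> Prop :=
  ideal_gen (fun y => exists (i : nat) (b : R),
               b \in B /\ y = iter i (@sigma R) b).

Section SigmaIdeals.
Variables (R S : diffRing) (B : seq R).

Lemma sigma_ideal_sub b : b \in B -> sigma_ideal B b.
Proof. by move=> Bb; apply: ideal_gen_sub; exists 0%N, b. Qed.

Lemma sigma_ideal_diff : is_diff_ideal (sigma_ideal B).
Proof.
split=> [|x]; first exact: ideal_gen_ideal.
move=> /(_ (fun y => sigma_ideal B (sigma y))); apply.
  exact: (rmorph_preim_ideal (@sigma R) (ideal_gen_ideal _)).
by move=> _ [i [b [Bb ->]]]; apply: ideal_gen_sub; exists i.+1, b.
Qed.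

Lemma diffHom_iter (h : diffHom R S) i x :
  h (iter i (@sigma R) x) = iter i (@sigma S) (h x).
Proof. by elim: i => //= i <-; rewrite diffHom_sigma. Qed.

Lemma sigma_ideal_kernel (h : diffHom R S) :
  (forall b, b \in B -> h b = 0) -> forall x, sigma_ideal B x -> h x = 0.
Proof.
move=> hB; apply: ideal_gen_kernel => _ [i [b [Bb ->]]].
by rewrite diffHom_iter hB //; elim: i => //= i ->; rewrite rmorph0.
Qed.

End SigmaIdeals.

(** * Quotients of difference algebras *)

Section DiffAlgebras.
Variable k : diffRing.
Implicit Types P A B C : diffAlg k.

Definition mkDiffAlgHom A B (u : {rmorphism A -> B})
    (us : forall x, u (sigma x) = sigma (u x))
    (um : forall c, u (diffAlg_map A c) = diffAlg_map B c) : diffAlgHom A B :=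
  @DiffAlgHom k A B (DiffHom us) um.

Definition diffAlgHom_id A : diffAlgHom A A :=
  @mkDiffAlgHom A A idfun (fun=> erefl) (fun=> erefl).

Definition diffAlgHom_comp A B C (g : diffAlgHom B C) (f : diffAlgHom A B) :
    diffAlgHom A C.
Proof.
apply: (@mkDiffAlgHom _ _ (g \o f : {rmorphism A -> C})) => [x|c] /=.
  by rewrite !diffHom_sigma.
by rewrite !diffAlgHom_map.
Defined.

Lemma diff_factor P A B (pi : diffAlgHom P A) (h : diffAlgHom P B) :
  (forall a, exists p, pi p = a) -> (forall p, pi p = 0 -> h p = 0) ->
  exists u : diffAlgHom A B, forall p, u (pi p) = h p.
Proof.
move=> surj ker; have [u uE] := rmorph_factor surj ker.
have us x : u (sigma x) = sigma (u x).
  by have [p <-] := surj x; rewrite -diffHom_sigma !uE diffHom_sigma.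
have um c : u (diffAlg_map A c) = diffAlg_map B c.
  by rewrite -(diffAlgHom_map pi) uE diffAlgHom_map.
by exists (mkDiffAlgHom us um).
Qed.

Lemma diff_quotient_exists P (J : P -> Prop) : is_diff_ideal J ->
  exists Q : diffAlg k, is_diff_quotient Q J.
Proof.
case=> idJ sJ; have [Q [pi [pi_surj pi_ker]]] := quotient_ring_exists idJ.
have [s sE] : exists s : {rmorphism Q -> Q}, forall p, s (pi p) = pi (sigma p).
  apply: (@rmorph_factor _ _ _ pi (pi \o @sigma P)) => // p /pi_ker Jp.
  by apply/pi_ker; apply: sJ.
pose Qr := DiffRing s.
have map_s c : (pi \o diffAlg_map P) (sigma c) = s ((pi \o diffAlg_map P) c).
  by rewrite /= diffHom_sigma sE.
pose Qa := @DiffAlg k Qr (@DiffHom k Qr (pi \o diffAlg_map P) map_s).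
by exists Qa, (@mkDiffAlgHom P Qa pi (fun p => esym (sE p)) (fun=> erefl)).
Qed.

(** Comparison with the quotient rho : P -> Q by J. The factorisations
u : A -> Q of rho and v : Q -> A of [pi] satisfy v u = id, because v u fixes
the image of [pi]; so [pi] is surjective along with v, and its kernel lies in
that of rho. *)
Lemma diff_quotient_of_universal P A (J : P -> Prop) (pi : diffAlgHom P A) :
  is_diff_ideal J -> (forall p, J p -> pi p = 0) ->
  (forall B (h : diffAlgHom P B), (forall p, J p -> h p = 0) ->
     exists u : diffAlgHom A B, forall p, u (pi p) = h p) ->
  (forall w : diffAlgHom A A, (forall p, w (pi p) = pi p) -> w =1 id) ->
  is_diff_quotient A J.
Proof.
move=> dJ piJ pi_factor pi_epi.
have [Q [rho [rho_surj rho_ker]]] := diff_quotient_exists dJ.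
have [u uE] := pi_factor Q rho (fun p => (rho_ker p).2).
have [v vE] : exists v : diffAlgHom Q A, forall p, v (rho p) = pi p.
  by apply: diff_factor => // p /rho_ker; apply: piJ.
have vu : diffAlgHom_comp v u =1 id by apply: pi_epi => p /=; rewrite uE vE.
exists pi; split=> [a|p].
  by have [p rp] := rho_surj (u a); exists p; rewrite -vE rp; apply: vu.
split=> [p0|]; last exact: piJ.
by apply/rho_ker; rewrite -uE p0 rmorph0.
Qed.

(** * Difference polynomial algebras *)

Definition diffX n (j : 'I_n) : diffPoly n k := cpolyX k (0%N, j).

Lemma diffPoly_varE n (i : nat) (j : 'I_n) :
  cpolyX k (i, j) = iter i (@sigma (diffPoly n k)) (diffX j).
Proof. by elim: i => //= i <-; rewrite /sigma /= diffPoly_sigmaX. Qed.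

Lemma diffPoly_ext n A (f g : diffAlgHom (diffPoly n k) A) :
  (forall j, f (diffX j) = g (diffX j)) -> f =1 g.
Proof.
move=> fg; apply: cpoly_rmorph_ext => [c|[i j]].
  exact: etrans (diffAlgHom_map f c) (esym (diffAlgHom_map g c)).
by rewrite diffPoly_varE; rewrite !diffHom_iter fg.
Qed.

Section Evaluation.
Variables (n : nat) (A : diffAlg k) (y : 'I_n -> A).

Let ev : {rmorphism diffPoly n k -> A} :=
  cpoly_eval (diffAlg_map A)
    (fun v : nat * 'I_n => iter v.1 (@sigma A) (y v.2)).

Let ev_sigma x : ev (sigma x) = sigma (ev x).
Proof.
move: x; apply: (@cpoly_rmorph_ext _ _ _
  (ev \o @sigma (diffPoly n k)) (@sigma A \o ev)) => [c|[i j]] /=.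
  by rewrite /sigma /= diffPoly_sigmaC /ev /= !cpoly_evalC diffHom_sigma.
by rewrite [in LHS]/sigma /= diffPoly_sigmaX /ev /= !cpoly_evalX.
Qed.

Definition diffPoly_evalHom : diffAlgHom (diffPoly n k) A :=
  @mkDiffAlgHom (diffPoly n k) A ev ev_sigma (fun c => cpoly_evalC _ _ c).

Lemma diffPoly_evalHomX j : diffPoly_evalHom (diffX j) = y j.
Proof. exact: cpoly_evalX. Qed.

End Evaluation.

(** Difference polynomial algebras are projective with respect to surjections:
only the images of the variables have to be lifted. *)
Lemma diffPoly_lift n A B (pi : diffAlgHom B A)
    (f : diffAlgHom (diffPoly n k) A) :
  (forall a, exists b, pi b = a) ->
  exists F : diffAlgHom (diffPoly n k) B, forall p, pi (F p) = f p.
Proof.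
move=> surj; have [r rK] := choice surj.
exists (diffPoly_evalHom (fun j => r (f (diffX j)))).
apply: (@diffPoly_ext n A (diffAlgHom_comp pi _)) => j.
by rewrite [LHS](congr1 pi (diffPoly_evalHomX _ j)) rK.
Qed.

End DiffAlgebras.

(** * Finite presentations *)

Section FinitePresentations.
Variable R : comPzRingType.

Lemma ideal_gen_map (S T : comPzRingType) (f : {rmorphism S -> T})
    (B : seq S) x :
  ideal_gen (fun y => y \in B) x ->
  ideal_gen (fun y => y \in [seq f b | b <- B]) (f x).
Proof.
move=> Bx J idJ BJ; apply: (Bx (fun y => J (f y))).
  exact: (rmorph_preim_ideal f idJ).
by move=> y By; apply: BJ; apply: map_f.
Qed.

(** The definition of finite presentation asks for variables indexed by
ordinals, whereas truncated difference polynomials have doubly indexed ones. *)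
Lemma fin_presented_finType (I : finType) (B : seq (cpoly R I)) (A : alg R) :
  @is_quotient R (poly_alg R I) A (ideal_gen (fun y => y \in B)) ->
  fin_presented A.
Proof.
case=> pi [pi_surj pi_ker]; pose n := #|I|.
pose e : algHom (poly_alg R 'I_n) (poly_alg R I) :=
  @poly_evalHom R 'I_n (poly_alg R I) (fun i => cpolyX R (enum_val i)).
pose e' : algHom (poly_alg R I) (poly_alg R 'I_n) :=
  @poly_evalHom R I (poly_alg R 'I_n) (fun v => cpolyX R (enum_rank v)).
have eK : cancel e e'.
  apply: (@poly_algHom_ext R _ _ (algHom_comp e' e) (algHom_id _)) => i.
  by rewrite [LHS](congr1 e' (poly_evalHomX _ i)) poly_evalHomX enum_valK.
have e'K : cancel e' e.
  apply: (@poly_algHom_ext R _ _ (algHom_comp e e') (algHom_id _)) => v.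
  by rewrite [LHS](congr1 e (poly_evalHomX _ v)) poly_evalHomX enum_rankK.
exists n, (ideal_gen (fun y => y \in [seq e' b | b <- B])); split.
- exact: ideal_gen_ideal.
- by exists [seq e' b | b <- B].
exists (algHom_comp pi e); split=> [a|p].
  by have [p <-] := pi_surj a; exists (e' p); rewrite /= e'K.
split=> [/pi_ker /(ideal_gen_map (f := algHom_fun e'))|]; first by rewrite eK.
move=> /(ideal_gen_map (f := algHom_fun e)).
by rewrite -map_comp (eq_map e'K) map_id => /pi_ker.
Qed.

Lemma poly_alg_fin_presented (I : finType) : fin_presented (poly_alg R I).
Proof.
apply: (@fin_presented_finType _ [::]); exists (algHom_id _).
split=> [a|p /=]; first by exists a.
by split=> [-> J [] //|/(_ (fun x => x = 0) (@zero_ideal _))]; apply.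
Qed.

End FinitePresentations.

Section SigmaPresentations.
Variable k : diffRing.
Implicit Types A B L X Y : diffAlg k.

Lemma fin_sigma_presentedP A :
  fin_sigma_presented A <->
  exists n (B : seq (diffPoly n k)), is_diff_quotient A (sigma_ideal B).
Proof.
split=> [[n [J [_ [B _ JB] [pi [pi_surj pi_ker]]]]]|[n [B AB]]].
  by exists n, B, pi; split=> // p; rewrite pi_ker JB.
exists n, (sigma_ideal B); split=> //; first exact: sigma_ideal_diff.
by exists B => // b; apply: sigma_ideal_sub.
Qed.

Lemma fin_sigma_presented_iso A L :
  diffAlg_iso A L -> fin_sigma_presented L -> fin_sigma_presented A.
Proof.
case=> u [v [uK vK]] /fin_sigma_presentedP[n [B [pi [pi_surj pi_ker]]]].
apply/fin_sigma_presentedP; exists n, B, (diffAlgHom_comp v pi).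
split=> [a|p].
  by have [p pa] := pi_surj (u a); exists p; rewrite /= pa uK.
rewrite -pi_ker /=; split=> [v0|->]; last by rewrite rmorph0.
by rewrite -(vK (pi p)) v0 rmorph0.
Qed.

Lemma fin_sigma_presented_coeq A : fin_sigma_presented A ->
  exists (m n : nat) (f g : diffAlgHom (diffPoly m k) (diffPoly n k))
    (q : diffAlgHom (diffPoly n k) A), is_coequaliser f g q.
Proof.
case/fin_sigma_presentedP=> n [B [pi [pi_surj pi_ker]]].
pose f : diffAlgHom (diffPoly (size B) k) (diffPoly n k) :=
  diffPoly_evalHom (tnth (in_tuple B)).
pose g : diffAlgHom (diffPoly (size B) k) (diffPoly n k) :=
  diffPoly_evalHom (fun=> 0).
exists (size B), n, f, g, pi; split=> [x|C h hfg].
  apply: (diffPoly_ext (f := diffAlgHom_comp pi f)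
                       (g := diffAlgHom_comp pi g)) => j.
  rewrite [LHS](congr1 pi (diffPoly_evalHomX _ j)).
  rewrite [RHS](congr1 pi (diffPoly_evalHomX _ j)) rmorph0.
  by apply/pi_ker; apply: sigma_ideal_sub; apply: mem_tnth.
have hB b : b \in B -> h b = 0.
  case/(tnthP (in_tuple B)) => j ->; have := hfg (diffX k j).
  by rewrite !diffPoly_evalHomX rmorph0.
have [u uE] : exists u : diffAlgHom A C, forall p, u (pi p) = h p.
  by apply: diff_factor => // p /pi_ker; apply: sigma_ideal_kernel.
by exists u => // u' u'E a; have [p <-] := pi_surj a; rewrite uE u'E.
Qed.

(** To the relations of Y one adds F(x_j) - G(x_j), where F and G lift f and g
along the presentations of X and Y: equality of f and g needs to be imposed
only on generators of X. *)
Lemma coeq_fin_sigma_presented X Y A (f g : diffAlgHom X Y)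
    (q : diffAlgHom Y A) :
  fin_sigma_presented X -> fin_sigma_presented Y -> is_coequaliser f g q ->
  fin_sigma_presented A.
Proof.
case/fin_sigma_presentedP=> m [_ [piX [piX_surj _]]].
case/fin_sigma_presentedP=> n [B [pi [pi_surj pi_ker]]] [qfg q_univ].
have [F FE] := diffPoly_lift (diffAlgHom_comp f piX) pi_surj.
have [G GE] := diffPoly_lift (diffAlgHom_comp g piX) pi_surj.
pose D := [seq F (diffX k j) - G (diffX k j) | j : 'I_m].
apply/fin_sigma_presentedP; exists n, (B ++ D).
apply: (@diff_quotient_of_universal _ _ _ _ (diffAlgHom_comp q pi)).
- exact: sigma_ideal_diff.
- apply: sigma_ideal_kernel => b; rewrite mem_cat.
  case/orP=> [Bb|/imageP[j _ ->]] /=.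
    by rewrite (pi_ker b).2 ?rmorph0 //; apply: sigma_ideal_sub.
  by rewrite !rmorphB FE GE /= qfg subrr.
- move=> C h hJ.
  have hBD b : b \in B ++ D -> h b = 0.
    by move=> ?; apply: hJ; apply: sigma_ideal_sub.
  have [v vE] : exists v : diffAlgHom Y C, forall p, v (pi p) = h p.
    apply: diff_factor => // p /pi_ker; apply: sigma_ideal_kernel => b Bb.
    by apply: hBD; rewrite mem_cat Bb.
  have hFG : diffAlgHom_comp h F =1 diffAlgHom_comp h G.
    apply: diffPoly_ext => j; apply/eqP; rewrite -subr_eq0 /= -rmorphB hBD //.
    by rewrite mem_cat image_f ?orbT.
  have [|u uE _] := q_univ C v.
    move=> x; have [p <-] := piX_surj x.
    by rewrite -[f _]FE -[g _]GE !vE; apply: hFG.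
  by exists u => p; rewrite /= uE vE.
move=> w wE; have [u uE u_uniq] := q_univ A q qfg.
have wu : w =1 u by apply: u_uniq => y; have [p <-] := pi_surj y; apply: wE.
by move=> a; rewrite wu -(u_uniq (diffAlgHom_id A)).
Qed.

(** The inclusion of ordinary polynomials as difference polynomials of
order 0. *)
Definition order0 n : algHom (poly_alg k 'I_n) (floor_alg (diffPoly n k)) :=
  @poly_evalHom k 'I_n (floor_alg (diffPoly n k)) (@diffX k n).

Lemma order0X n (j : 'I_n) : order0 n (cpolyX k j) = diffX k j :> diffPoly n k.
Proof. exact: (@poly_evalHomX k 'I_n (floor_alg (diffPoly n k))). Qed.

Lemma order0_ext n B (h : diffAlgHom (diffPoly n k) B)
    (f : algHom (poly_alg k 'I_n) (floor_alg B)) :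
  (forall j, h (diffX k j) = f (cpolyX k j)) -> forall p, h (order0 n p) = f p.
Proof.
move=> hf.
apply: (poly_algHom_ext (f := algHom_comp (floor_algHom h) (order0 n))) => j.
by rewrite [LHS](congr1 h (order0X j)).
Qed.

Lemma diffPoly_free n : is_free_diffAlg (order0 n).
Proof.
move=> B f; pose h := diffPoly_evalHom (fun j => f (cpolyX k j)).
have hX j : h (diffX k j) = f (cpolyX k j) by apply: diffPoly_evalHomX.
exists h => [|h' h'E]; first exact: order0_ext.
apply: diffPoly_ext => j; rewrite hX -h'E.
by rewrite [RHS](congr1 h' (order0X j)).
Qed.

(** * Cocorrespondences *)

Lemma cocorr_s_map (Z : cocorr k) c :
  cocorr_s Z (alg_map (cocorr_src Z) c) = alg_map (cocorr_tgt Z) (sigma c).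
Proof. by rewrite -[alg_map _ c]mulr1 cocorr_sE rmorph1 mulr1. Qed.

(** The condition sigma c p = c s under which a morphism c : C_0 -> B is a
point of the functor represented by the free algebra on a cocorrespondence. *)
Definition cocorr_compat (Z : cocorr k) B
    (c : algHom (cocorr_tgt Z) (floor_alg B)) : Prop :=
  forall a, c (cocorr_s Z a) = sigma (c (cocorr_p Z a) : B).

Definition cocorrHom_of (Z : cocorr k) B
    (c : algHom (cocorr_tgt Z) (floor_alg B)) (cs : cocorr_compat c) :
    cocorrHom Z (diffAlg_cocorr B) :=
  @CocorrHom k Z (diffAlg_cocorr B)
    (algHom_comp c (cocorr_p Z)) c (fun=> erefl) cs.

Lemma cocorrHom_compat (Z : cocorr k) B (f : cocorrHom Z (diffAlg_cocorr B)) :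
  cocorr_compat (B := B) (cocorrHom_tgt f).
Proof.
move=> a; apply: etrans (cocorrHom_s f a) _.
exact: (congr1 (@sigma B : B -> B) (esym (cocorrHom_p f a))).
Qed.

(** A morphism of cocorrespondences to B -id-> B <-sigma- B is determined by its
component c on the target: its component on the source is c p. *)
Lemma free_cocorrP (Z : cocorr k) L (eta : cocorrHom Z (diffAlg_cocorr L)) :
  is_free_cocorr eta <->
  forall B (c : algHom (cocorr_tgt Z) (floor_alg B)), cocorr_compat c ->
    exists2 h : diffAlgHom L B, forall x, h (cocorrHom_tgt eta x) = c x &
      forall h' : diffAlgHom L B, (forall x, h' (cocorrHom_tgt eta x) = c x) ->
        h' =1 h.
Proof.
have etaE a : cocorrHom_src eta a = cocorrHom_tgt eta (cocorr_p Z a).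
  by rewrite [RHS](cocorrHom_p eta).
split=> [free B c cs|univ ext B f].
  have [h [_ hE] h_uniq] := free B (cocorrHom_of cs).
  exists h => // h' h'E; apply: h_uniq; split=> // a.
  by rewrite etaE; apply: h'E.
have [h hE h_uniq] := univ B (cocorrHom_tgt f) (cocorrHom_compat f).
exists h => [|h' [_ h'E]]; last exact: h_uniq.
split=> // a; rewrite etaE; apply: etrans (hE _) _.
exact: (cocorrHom_p f).
Qed.


(** With a_j generating A_0, the relations are those of C_0 in order 0 and, for
each j, the equation between a lift of s(a_j) and sigma of a lift of p(a_j).
They suffice because sigma c p and c s agree on constants by semilinearity, and
so agree on A_0 once they do on the a_j. *)
Lemma cocorr_fin_sigma_presented (Z : cocorr k) L
    (eta : cocorrHom Z (diffAlg_cocorr L)) :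
  fin_presented (cocorr_src Z) -> fin_presented (cocorr_tgt Z) ->
  is_free_cocorr eta -> fin_sigma_presented L.
Proof.
case=> m [_ [_ _ [piA [piA_surj _]]]].
case=> n [J [_ [BC JE] [piC [piC_surj piC_ker]]]].
move=> /free_cocorrP free.
have [r rK] := choice piC_surj.
pose a j := piA (cpolyX k j).
pose D (j : 'I_m) : diffPoly n k := order0 n (r (cocorr_s Z (a j))) -
  sigma (order0 n (r (cocorr_p Z (a j))) : diffPoly n k).
pose B : seq (diffPoly n k) := map (order0 n) BC ++ [seq D j | j : 'I_m].
pose et : algHom (cocorr_tgt Z) (floor_alg L) := cocorrHom_tgt eta.
pose phi := diffPoly_evalHom (fun j => et (piC (cpolyX k j)) : L).
have phi0 p : phi (order0 n p) = et (piC p).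
  apply: (order0_ext (f := algHom_comp et piC)) => j.
  exact: diffPoly_evalHomX.
apply/fin_sigma_presentedP; exists n, B.
apply: (@diff_quotient_of_universal _ _ _ _ phi).
- exact: sigma_ideal_diff.
- apply: sigma_ideal_kernel => b; rewrite mem_cat.
  case/orP=> [/mapP[p BCp ->]|/imageP[j _ ->]].
    rewrite phi0 (piC_ker p).2 ?rmorph0 //.
    by apply/JE; apply: ideal_gen_sub.
  rewrite /D rmorphB diffHom_sigma !phi0 !rK.
  by apply/eqP; rewrite subr_eq0; apply/eqP; apply: (cocorrHom_compat eta).
- move=> C h hJ.
  have hB b : b \in B -> h b = 0 by move=> ?; apply: hJ; apply: sigma_ideal_sub.
  have [c cE] : exists c : algHom (cocorr_tgt Z) (floor_alg C),
      forall p, c (piC p) = h (order0 n p).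
    apply: (alg_factor (h := algHom_comp (floor_algHom h) (order0 n))) => // p.
    move=> /piC_ker /JE.
    apply: (@ideal_gen_kernel _ _
      (algHom_comp (floor_algHom h) (order0 n))) => b BCb.
    by apply: hB; rewrite mem_cat map_f.
  have cs : cocorr_compat (B := C) c.
    move=> x; have [q <-] := piA_surj x; move: q.
    apply: (@cpoly_rmorph_ext _ _ _ (c \o cocorr_s Z \o piA)
      (@sigma C \o (c \o cocorr_p Z \o piA))) => [d|j] /=.
      have -> : piA (cpolyC _ d) = alg_map _ d := algHom_map piA d.
      by rewrite cocorr_s_map !algHom_map /= diffHom_sigma.
    have := hB (D j); rewrite mem_cat image_f ?orbT // => /(_ isT) /eqP.
    by rewrite /D rmorphB diffHom_sigma subr_eq0 -!cE !rK => /eqP.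
  have [u uE _] := free C c cs.
  exists u; apply: (diffPoly_ext (f := diffAlgHom_comp u phi)) => j.
  rewrite [LHS](congr1 u (diffPoly_evalHomX _ j)) [LHS]uE cE.
  by rewrite [LHS](congr1 h (order0X j)).
move=> w wE.
have [u uE u_uniq] := free L et (cocorrHom_compat eta).
have wu : w =1 u.
  by apply: u_uniq => x; have [p <-] := piC_surj x; rewrite -phi0; apply: wE.
by move=> x; rewrite wu -(u_uniq (diffAlgHom_id L)).
Qed.

(** The free difference algebra on C_0 is the free one on the cocorrespondence
k -> C_0 <- k, whose compatibility condition is void; k is taken as the
polynomial ring in no variables. *)
Lemma free_fin_sigma_presented (C0 : alg k) L (eta : algHom C0 (floor_alg L)) :
  fin_presented C0 -> is_free_diffAlg eta -> fin_sigma_presented L.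
Proof.
move=> fpC free.
pose p := @poly_evalHom k 'I_0 C0 (fun=> 0).
pose s : {rmorphism poly_alg k 'I_0 -> C0} :=
  cpoly_eval (alg_map C0 \o @sigma k) (fun=> 0).
have sE c x : s (alg_map (poly_alg k 'I_0) c * x) = alg_map C0 (sigma c) * s x.
  by rewrite rmorphM; congr (_ * _); apply: cpoly_evalC.
pose Z := @Cocorr k (poly_alg k 'I_0) C0 p s sE.
have compat B (c : algHom C0 (floor_alg B)) : @cocorr_compat Z B c.
  apply: (@cpoly_rmorph_ext _ _ _
    (c \o s) (@sigma B \o (c \o p))) => [d|[]//] /=.
  rewrite [s _]cpoly_evalC.
  have -> : p (cpolyC _ d) = alg_map _ d := algHom_map p d.
  by rewrite !algHom_map /= diffHom_sigma.
apply: (@cocorr_fin_sigma_presented Z L (cocorrHom_of (compat L eta))) => //.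
  exact: (poly_alg_fin_presented k 'I_0).
by apply/free_cocorrP => B c _; apply: free.
Qed.

End SigmaPresentations.

(** * Bounded order *)

Section BoundedOrder.
Variables (k : diffRing) (n : nat).

Definition bounded_incl (N : nat) :
    algHom (poly_alg k ('I_N.+1 * 'I_n)%type) (floor_alg (diffPoly n k)) :=
  @poly_evalHom k ('I_N.+1 * 'I_n)%type (floor_alg (diffPoly n k))
    (fun v : 'I_N.+1 * 'I_n => cpolyX k (v.1 : nat, v.2)).

(** A retraction of the inclusion, defined on all difference polynomials; the
variables of order above N are sent to junk (the default value of [inord]). *)
Definition truncate (N : nat) :
    algHom (floor_alg (diffPoly n k)) (poly_alg k ('I_N.+1 * 'I_n)%type) :=
  @poly_evalHom k (nat * 'I_n)%type (poly_alg k ('I_N.+1 * 'I_n)%type)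
    (fun v : nat * 'I_n => cpolyX k (inord v.1 : 'I_N.+1, v.2)).

(** Stated for all large N, rather than for one N, so that bounds for two
polynomials can be combined by taking their maximum. *)
Lemma truncateK (p : diffPoly n k) :
  exists N0, forall N, (N0 <= N)%N -> bounded_incl N (truncate N p) = p.
Proof.
move: p; apply: cpoly_ind => [c|[i j]|p q [M Mp] [N Nq]|p q [M Mp] [N Nq]].
- exists 0%N => N _; apply: etrans (congr1 _ (algHom_map (truncate N) c)) _.
  exact: algHom_map.
- exists i => N leiN.
  have tX : truncate N (cpolyX k (i, j)) = cpolyX k (inord i, j).
    exact: (@poly_evalHomX k (nat * 'I_n)%type).
  rewrite tX.
  apply: etrans (@poly_evalHomX k _ (floor_alg (diffPoly n k)) _ _) _.
  by rewrite /= inordK.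
- exists (maxn M N) => K; rewrite geq_max => /andP[leM leN].
  by rewrite !rmorphD /= Mp ?Nq.
- exists (maxn M N) => K; rewrite geq_max => /andP[leM leN].
  by rewrite !rmorphM /= Mp ?Nq.
Qed.

Lemma truncateK_seq (B : seq (diffPoly n k)) :
  exists N, forall b, b \in B -> bounded_incl N (truncate N b) = b.
Proof.
suff [N0 BN] : exists N0, forall N, (N0 <= N)%N ->
    forall b, b \in B -> bounded_incl N (truncate N b) = b.
  by exists N0; apply: BN.
elim: B => [|b B [M MB]]; first by exists 0%N.
have [N Nb] := truncateK b.
exists (maxn M N) => K; rewrite geq_max => /andP[leM leN] x.
by rewrite inE => /predU1P[->|/MB]; [apply: Nb | apply].
Qed.

End BoundedOrder.

Section CocorrOfPresentation.
Variables (k : diffRing) (n : nat) (A : diffAlg k).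
Variables (B : seq (diffPoly n k)) (pi : diffAlgHom (diffPoly n k) A).
Hypothesis pi_surj : forall a, exists p, pi p = a.
Hypothesis pi_ker : forall p, pi p = 0 <-> sigma_ideal B p.

(** C_0 has variables x_(i,j), i <= N, and the truncated relations; A_0 has
variables x_(i,j), i < N, with p : x_(i,j) |-> x_(i,j) and s semilinear with
x_(i,j) |-> x_(i+1,j). A compatible point of C_0 is a choice of values y_(i,j)
satisfying the relations with y_(i+1,j) = sigma(y_(i,j)), that is, a choice of
y_(0,j) whose iterates under sigma satisfy them: a point of A. So A itself is
the free algebra on this cocorrespondence. *)
Lemma fin_sigma_presented_cocorr : exists X : cocorr k,
  fin_presented (cocorr_src X) /\ fin_presented (cocorr_tgt X) /\
  exists eta : cocorrHom X (diffAlg_cocorr A), is_free_cocorr eta.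
Proof.
have [N BN] := truncateK_seq B.
pose V : finType := ('I_N.+1 * 'I_n)%type.
pose tB : seq (cpoly k V) := [seq truncate k n N b | b <- B].
have [C0 [rho [rho_surj rho_ker]]] :=
  alg_quotient_exists (P := poly_alg k V) (ideal_gen_ideal (fun y => y \in tB)).
pose Z i j : C0 := rho (cpolyX k ((i, j) : V)).
pose A0 := poly_alg k ('I_N * 'I_n)%type.
pose p : algHom A0 C0 := @poly_evalHom k ('I_N * 'I_n)%type C0
  (fun v : 'I_N * 'I_n => Z (widen_ord (leqnSn N) v.1) v.2).
pose s : {rmorphism A0 -> C0} := cpoly_eval (alg_map C0 \o @sigma k)
  (fun v : 'I_N * 'I_n => Z (lift ord0 v.1) v.2).
have sE c x : s (alg_map A0 c * x) = alg_map C0 (sigma c) * s x.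
  by rewrite rmorphM; congr (_ * _); apply: cpoly_evalC.
pose X := @Cocorr k A0 C0 p s sE.
have pX i j : p (cpolyX k (i, j)) = Z (widen_ord (leqnSn N) i) j.
  exact: (@poly_evalHomX k ('I_N * 'I_n)%type).
have sX i j : s (cpolyX k (i, j)) = Z (lift ord0 i) j by apply: cpoly_evalX.
have inclX i j : bounded_incl k n N (cpolyX k (i, j)) = cpolyX k (i : nat, j).
  exact: (@poly_evalHomX k _ (floor_alg (diffPoly n k))).
have [et etE] : exists et : algHom C0 (floor_alg A),
    forall q, et (rho q) = pi (bounded_incl k n N q).
  apply: (alg_factor
    (h := algHom_comp (floor_algHom pi) (bounded_incl k n N))) => // q.
  move=> /rho_ker; apply: (@ideal_gen_kernel _ _
     (algHom_comp (floor_algHom pi) (bounded_incl k n N))) => _ /mapP[b Bb ->].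
  by rewrite /= BN //; apply/pi_ker; apply: sigma_ideal_sub.
have etZ i j : et (Z i j) = pi (cpolyX k (i : nat, j)).
  by rewrite etE inclX.
have ets : @cocorr_compat k X A et.
  apply: (@cpoly_rmorph_ext _ _ _
    (et \o s) (@sigma A \o (et \o p))) => [d|[i j]] /=.
    rewrite [s _]cpoly_evalC.
    have -> : p (cpolyC _ d) = alg_map _ d := algHom_map p d.
    by rewrite !algHom_map /= diffHom_sigma.
  by rewrite sX pX !etZ -diffHom_sigma /sigma /= diffPoly_sigmaX.
exists X; split; last split.
- exact: (poly_alg_fin_presented k ('I_N * 'I_n)%type).
- by apply: (@fin_presented_finType _ _ tB); exists rho.
exists (cocorrHom_of ets); apply/free_cocorrP => C c cs.
pose h := diffPoly_evalHom (fun j => c (Z ord0 j) : C).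
(* Compatibility at x_(i,j) is the recursion y_(i+1,j) = sigma(y_(i,j)). *)
have hX i j : (i < N.+1)%N -> h (cpolyX k (i, j)) = c (Z (inord i) j).
  rewrite diffPoly_varE diffHom_iter diffPoly_evalHomX.
  elim: i => [|i IHi] ltiN /=.
    by congr (c (Z _ _)); apply/val_inj; rewrite /= inordK.
  pose i' : 'I_N := Ordinal (ltiN : (i < N)%N).
  rewrite IHi; last exact: ltnW.
  have := cs (cpolyX k (i', j)); rewrite /= sX pX => cZ.
  have -> : inord i = widen_ord (leqnSn N) i'.
    by apply/val_inj; rewrite /= inordK // ltnW.
  by rewrite -cZ; congr (c (Z _ _)); apply/val_inj; rewrite /= inordK.
have hE q : h (bounded_incl k n N q) = c (rho q).
  move: q; apply: (poly_algHom_ext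
    (f := algHom_comp (floor_algHom h) (bounded_incl k n N))
    (g := algHom_comp c rho)) => -[i j].
  by rewrite [LHS](congr1 h (inclX i j)) hX // inord_val.
have [u uE] : exists u : diffAlgHom A C, forall q, u (pi q) = h q.
  apply: diff_factor => // q /pi_ker; apply: sigma_ideal_kernel => b Bb.
  rewrite -(BN b Bb) hE (rho_ker _).2 ?rmorph0 //.
  by apply: ideal_gen_sub; apply: map_f.
exists u => [x|u' u'E a].
  by have [q <-] := rho_surj x; rewrite /= etE uE hE.
have [q <-] := pi_surj a; rewrite uE.
apply: (diffPoly_ext (f := diffAlgHom_comp u' pi)) => j.
by rewrite diffPoly_evalHomX -u'E /= etZ.
Qed.

End CocorrOfPresentation.

Theorem lemma2p35 (k : diffRing) (A : diffAlg k) :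
  [<->
    fin_sigma_presented A;
    exists (m n : nat) (f g : diffAlgHom (diffPoly m k) (diffPoly n k))
           (q : diffAlgHom (diffPoly n k) A),
      is_coequaliser f g q;
    exists (A0 C0 : alg k), fin_presented A0 /\ fin_presented C0 /\
      exists (LA LC : diffAlg k)
             (etaA : algHom A0 (floor_alg LA)) (etaC : algHom C0 (floor_alg LC)),
        is_free_diffAlg etaA /\ is_free_diffAlg etaC /\
        exists (f g : diffAlgHom LA LC) (q : diffAlgHom LC A),
          is_coequaliser f g q;
    exists X : cocorr k,
      fin_presented (cocorr_src X) /\ fin_presented (cocorr_tgt X) /\
      exists (L : diffAlg k) (eta : cocorrHom X (diffAlg_cocorr L)),
        is_free_cocorr eta /\ diffAlg_iso A L
  ].
Proof.
tfae.
- exact: fin_sigma_presented_coeq.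
- case=> m [n coeq]; exists (poly_alg k 'I_m), (poly_alg k 'I_n).
  split; [exact: (poly_alg_fin_presented k 'I_m) | split].
    exact: (poly_alg_fin_presented k 'I_n).
  exists (diffPoly m k), (diffPoly n k), (order0 k m), (order0 k n).
  by do 2![split; first exact: diffPoly_free].
- case=> A0 [C0 [fpA [fpC [LA [LC [etaA [etaC [freeA [freeC coeq]]]]]]]]].
  have {coeq} : fin_sigma_presented A.
    case: coeq => f [g [q coeq]].
    exact: coeq_fin_sigma_presented (free_fin_sigma_presented fpA freeA)
      (free_fin_sigma_presented fpC freeC) coeq.
  case/fin_sigma_presentedP=> n [B [pi [pi_surj pi_ker]]].
  have [X [fpS [fpT [eta free]]]] := fin_sigma_presented_cocorr pi_surj pi_ker.
  exists X; split=> //; split=> //; exists A, eta; split=> //.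
  by exists (diffAlgHom_id A), (diffAlgHom_id A).
- move=> [X [fpS [fpT [L [eta [free isoAL]]]]]].
  exact: fin_sigma_presented_iso isoAL (cocorr_fin_sigma_presented fpS fpT free).
Qed.
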